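(* Let $\sigma$ be the order two automorphism of $\mathcal{O}_2$ exchanging its two canonical generating isometries $S_1$ and $S_2$. There exists a *-isomorphism $\tau:\mathcal{O}_2\rtimes_\sigma\mathbb{Z}_2\longrightarrow\mathcal{O}_2$ such that $\tau(\mathcal{O}_2)$ is the fixed point C*-algebra $\{a\in\mathcal{O}_2:\sigma(a)=a\}$ of $\sigma$, where $\mathcal{O}_2$ is regarded as a C*-subalgebra of $\mathcal{O}_2\rtimes_\sigma\mathbb{Z}_2$ in the canonical way.
   Context: The Cuntz algebra $\mathcal{O}_2$ is the universal unital (simple) C*-algebra generated by two isometries $S_1,S_2$ with $S_1S_1^*+S_2S_2^*=1$. By universality there is a unique *-automorphism $\sigma$ of $\mathcal{O}_2$ with $\sigma(S_1)=S_2$ and $\sigma(S_2)=S_1$; it satisfies $\sigma^2=\mathrm{id}$, so it defines an action of $\mathbb{Z}_2=\mathbb{Z}/2\mathbb{Z}$. The C*-crossed-product $\mathcal{O}_2\rtimes_\sigma\mathbb{Z}_2$ is the universal C*-algebra generated by two isometries $S_1,S_2$ with $S_1S_1^*+S_2S_2^*=1$ and a unitary $W$ such that $W^2=1$ and $WS_1=S_2W$; the canonical copy of $\mathcal{O}_2$ in it is the C*-subalgebra generated by $S_1$ and $S_2$. *)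

(* Defs.v *)
From HB Require Import structures.
From mathcomp Require Import all_boot all_order all_algebra.
From mathcomp Require Import all_classical all_reals all_analysis.
From mathcomp Require Export complex.

Set Implicit Arguments.
Unset Strict Implicit.
Unset Printing Implicit Defensive.

Import Order.TTheory GRing.Theory Num.Theory.
Import numFieldNormedType.Exports.

Local Open Scope classical_set_scope.
Local Open Scope ring_scope.
Local Open Scope complex_scope.

(* Unital C*-algebras: the complex Banach space is the library's, and the
   multiplication and the involution come with the mixin; Hierarchy-Builder
   cannot join normed modules with rings above [numDomainType].  The ring and
   algebra structures are recovered by the instances below.
   The norm of a normed space over R[i] takes its values in R[i]; these are
   nonnegative, hence real, so the norm axioms are the usual ones.
   The zero algebra is excluded, as for all MathComp algebras; since it receives
   exactly one map from every algebra, universal properties are unaffected. *)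
HB.mixin Record isCstarAlgebra (R : realType) A
    of CompleteNormedModule R[i] A := {
  cstar_one : A;
  cstar_mul : A -> A -> A;
  star : A -> A;
  cstar_mulA : associative cstar_mul;
  cstar_mul1l : left_id cstar_one cstar_mul;
  cstar_mul1r : right_id cstar_one cstar_mul;
  cstar_mulDl : left_distributive cstar_mul +%R;
  cstar_mulDr : right_distributive cstar_mul +%R;
  cstar_one_neq0 : cstar_one != 0;
  cstar_scaleAl : forall (a : R[i]) (x y : A),
    a *: cstar_mul x y = cstar_mul (a *: x) y;
  cstar_scaleAr : forall (a : R[i]) (x y : A),
    a *: cstar_mul x y = cstar_mul x (a *: y);
  starK : forall x : A, star (star x) = x;
  starD : forall x y : A, star (x + y) = star x + star y;
  starZ : forall (a : R[i]) (x : A), star (a *: x) = a^* *: star x;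
  star_mul : forall x y : A, star (cstar_mul x y) = cstar_mul (star y) (star x);
  cstar_norm_mul : forall x y : A, `|cstar_mul x y| <= `|x| * `|y|;
  cstar_norm_star_mul : forall x : A, `|cstar_mul (star x) x| = `|x| ^+ 2
}.

#[short(type="cstarAlgType")]
HB.structure Definition CstarAlgebra (R : realType) :=
  {A of isCstarAlgebra R A & CompleteNormedModule R[i] A}.

#[export, non_forgetful_inheritance]
HB.instance Definition _ (R : realType) (A : cstarAlgType R) :=
  GRing.Zmodule_isNzRing.Build (CstarAlgebra.sort A)
    (@cstar_mulA R A) (@cstar_mul1l R A) (@cstar_mul1r R A)
    (@cstar_mulDl R A) (@cstar_mulDr R A) (@cstar_one_neq0 R A).

#[export, non_forgetful_inheritance]
HB.instance Definition _ (R : realType) (A : cstarAlgType R) :=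
  GRing.Lmodule_isLalgebra.Build R[i] (CstarAlgebra.sort A)
    (@cstar_scaleAl R A).

#[export, non_forgetful_inheritance]
HB.instance Definition _ (R : realType) (A : cstarAlgType R) :=
  GRing.Lalgebra_isAlgebra.Build R[i] (CstarAlgebra.sort A)
    (@cstar_scaleAr R A).

Definition is_star_hom (R : realType) (A B : cstarAlgType R)
    (f : {lrmorphism A -> B}) : Prop :=
  {morph f : x / star x}.

Definition is_star_isom (R : realType) (A B : cstarAlgType R)
    (f : {lrmorphism A -> B}) : Prop :=
  is_star_hom f /\ bijective f.

(* As usual, a C*-subalgebra need not contain the unit of the ambient one. *)
Record is_cstar_subalgebra (R : realType) (A : cstarAlgType R)
    (M : set A) : Prop := {
  cstar_sub0 : M 0;
  cstar_subD : forall x y, M x -> M y -> M (x + y);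
  cstar_subZ : forall (a : R[i]) x, M x -> M (a *: x);
  cstar_subM : forall x y, M x -> M y -> M (x * y);
  cstar_sub_star : forall x, M x -> M (star x);
  cstar_sub_closed : closed M
}.

Definition cstar_gen (R : realType) (A : cstarAlgType R) (G : set A) : set A :=
  smallest (@is_cstar_subalgebra R A) G.

Definition isometry (R : realType) (A : cstarAlgType R) (s : A) : Prop :=
  star s * s = 1.

Definition unitary (R : realType) (A : cstarAlgType R) (u : A) : Prop :=
  star u * u = 1 /\ u * star u = 1.

Definition cuntz2_rel (R : realType) (A : cstarAlgType R) (S1 S2 : A) : Prop :=
  [/\ isometry S1, isometry S2 & S1 * star S1 + S2 * star S2 = 1].

(* Uniqueness of the *-homomorphism given by universality is not required: it
   follows from the generation clause. *)
Definition is_cuntz2 (R : realType) (O : cstarAlgType R) (S1 S2 : O) : Prop :=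
  [/\ cuntz2_rel S1 S2,
      cstar_gen [set S1; S2] = setT
    & forall (B : cstarAlgType R) (T1 T2 : B), cuntz2_rel T1 T2 ->
        exists f : {lrmorphism O -> B},
          [/\ is_star_hom f, f S1 = T1 & f S2 = T2]].

Definition cuntz2_flip_rel (R : realType) (A : cstarAlgType R)
    (S1 S2 W : A) : Prop :=
  [/\ cuntz2_rel S1 S2, unitary W, W ^+ 2 = 1 & W * S1 = S2 * W].

(* The crossed product of O_2 by the flip, given by generators and relations;
   the last relation also yields W * S2 = S1 * W. *)
Definition is_cuntz2_flip_crossed_product (R : realType) (A : cstarAlgType R)
    (S1 S2 W : A) : Prop :=
  [/\ cuntz2_flip_rel S1 S2 W,
      cstar_gen [set S1; S2; W] = setT
    & forall (B : cstarAlgType R) (T1 T2 U : B), cuntz2_flip_rel T1 T2 U ->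
        exists f : {lrmorphism A -> B},
          [/\ is_star_hom f, f S1 = T1, f S2 = T2 & f W = U]].

(* Main.v *)
Require Import Defs.
From HB Require Import structures.
From mathcomp Require Import all_boot all_order all_algebra.
From mathcomp Require Import all_classical all_reals all_analysis.

Set Implicit Arguments.
Unset Strict Implicit.
Unset Printing Implicit Defensive.

Import Order.TTheory GRing.Theory Num.Theory.
Import numFieldNormedType.Exports.

Local Open Scope classical_set_scope.
Local Open Scope ring_scope.

(** Rotating the generators of O_2 to T1 = (S1 + S2) / sqrt 2 and
    T2 = (S1 - S2) / sqrt 2 turns the flip sigma into the grading with T1 even
    and T2 odd.  The self-adjoint unitary U = T1 T2^* + T2 T1^* is odd and
    exchanges T1 and T2 under left multiplication, so T1 and U T1 U = T2 U are
    isometries of O_2 which, with U, satisfy the relations of the crossed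
    product ([cuntz2_implements_flip]).  Universality gives
    tau : V1, V2, W |-> T1, T2 U, U.  Conversely V1 and W V1 satisfy the Cuntz
    relation in the crossed product, which gives a map f back sending T1, T2 to
    V1, W V1; the two composites fix generators, hence are identities.

    As T1 and T2 U are even, tau carries the C*-subalgebra F generated by V1
    and V2 into the fixed points.
    For the converse, f sigma tau is the dual action alpha: it fixes V1 and V2
    and negates W.  Conjugation by W exchanges V1 and V2, hence preserves F, so
    F + W F is a C*-subalgebra and is everything; on p + W q the map alpha is
    p - W q, and its fixed points are exactly F ([dual_action_fixed]).

    That *-homomorphisms are determined by generators, and that F + W F is
    closed, rests on the continuity of *-homomorphisms.  It is obtained without
    spectral theory: a small self-adjoint h has a square root y of 1 - h^2
    commuting with it ([sqrt_one_sub_sqr]), u = h + i y is then an isometry,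
    and h, the real part of u, is mapped to an element of norm at most 1. *)

(** * The involution and the norm *)

Section Star.
Context {R : realType} {A : cstarAlgType R}.
Implicit Types (x y u : A) (a : R[i]).

Lemma starM x y : star (x * y) = star y * star x.
Proof. exact: star_mul. Qed.

Lemma star0 : star (0 : A) = 0.
Proof. by apply: (addrI (star 0)); rewrite -starD !addr0. Qed.

Lemma starN x : star (- x) = - star x.
Proof. by apply: (addrI (star x)); rewrite -starD !subrr star0. Qed.

Lemma starB x y : star (x - y) = star x - star y.
Proof. by rewrite starD starN. Qed.

Lemma star1 : star (1 : A) = 1.
Proof. by rewrite -[LHS]mulr1 -[X in _ * X]starK -starM mulr1 starK. Qed.

Lemma normr_mul x y : `|x * y| <= `|x| * `|y|.
Proof. exact: cstar_norm_mul. Qed.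

Lemma normr_starM x : `|star x * x| = `|x| ^+ 2.
Proof. exact: cstar_norm_star_mul. Qed.

(** Submultiplicativity in the C*-identity gives |z|^2 <= |z^*| |z|; the other
    inequality is the same one for z^*. *)
Lemma normr_star x : `|star x| = `|x|.
Proof.
have le_star (z : A) : `|z| <= `|star z|.
  have [->|z0] := eqVneq z 0; first by rewrite star0.
  have z_gt0 : 0 < `|z| by rewrite normr_gt0.
  by rewrite -(ler_pM2r z_gt0) -expr2 -normr_starM normr_mul.
by apply/eqP; rewrite eq_le -{2}[x]starK !le_star.
Qed.

Lemma normr_isometry u : Defs.isometry u -> `|u| = 1.
Proof.
have n1 : `|1 : A| = 1.
  have n1_neq0 : `|1 : A| != 0 by rewrite normr_eq0 oner_neq0.
  by apply: (mulfI n1_neq0); rewrite mulr1 -expr2 -normr_starM star1 mulr1.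
move=> uu; have := normr_starM u; rewrite [_ * _]uu n1 => /esym /eqP.
rewrite sqrf_eq1 => /orP[/eqP //|/eqP u1].
by have := normr_ge0 u; rewrite u1 oppr_ge0 ler10.
Qed.

End Star.

(** * Sequences with geometrically decreasing steps *)

Section Geometric.
Context {R : realType}.

Lemma add_halves : 2^-1 + 2^-1 = 1 :> R[i].
Proof. by rewrite [RHS]splitr mul1r. Qed.

(** The scalars R[i] are only partially ordered; a positive one is real, so the
    Archimedean property of R applies to its real part. *)
Lemma geometric_lt (e : R[i]) : 0 < e -> exists n : nat, 2^-1 ^+ n < e.
Proof.
case: e => a b; rewrite ltcE /= => /andP[/eqP-> a_gt0].
exists (Num.bound a^-1).
have a_inv : a^-1 < 2 ^+ Num.bound a^-1.
  apply: lt_le_trans (archi_boundP _) _; first by rewrite invr_ge0 ltW.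
  rewrite -natrX ler_nat; apply: ltnW; exact: ltn_expl.
have -> : (2 : R[i])^-1 = (2^-1)%:C%C by rewrite fmorphV rmorph_nat.
rewrite -rmorphXn /= ltcE /= eqxx /= exprVn.
by rewrite -[ltRHS]invrK ltf_pV2 // posrE ?invr_gt0 ?exprn_gt0.
Qed.

(** Identities in a limit are proved by bounding the difference of the two
    sides by C / 2^n for each n. *)
Lemma le_geometric_eq0 {A : cstarAlgType R} (x : A) (C : R[i]) :
  0 <= C -> (forall n, `|x| <= C * 2^-1 ^+ n) -> x = 0.
Proof.
move=> C0 xC; apply/eqP; apply: contraT => x_neq0.
have x_gt0 : 0 < `|x| by rewrite normr_gt0.
have C_gt0 : 0 < C.
  rewrite lt_def C0 andbT; apply: contraTneq (xC 0) => ->.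
  by rewrite mul0r normr_le0.
have [n] := @geometric_lt (`|x| / C) (divr_gt0 x_gt0 C_gt0).
rewrite ltr_pdivlMr // mulrC => xn.
by have := le_lt_trans (xC n) xn; rewrite ltxx.
Qed.

(** The limit comes with its rate, which is what [le_geometric_eq0] consumes. *)
Lemma geometric_cvg {A : cstarAlgType R} (w : nat -> A) :
    (forall n, `|w n.+1 - w n| <= 2^-1 ^+ n.+1) ->
  exists l, forall n, `|l - w n| <= 2^-1 ^+ n.
Proof.
move=> wS.
(* Telescoping, with the remainder kept so that the induction closes. *)
have dist (n m : nat) : `|w (n + m)%N - w n| <= 2^-1 ^+ n - 2^-1 ^+ (n + m)%N.
  elim: m => [|m IH]; first by rewrite addn0 !subrr normr0.
  rewrite addnS -(subrK (w (n + m)%N) (w (n + m).+1)) -addrA.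
  apply: (le_trans (ler_normD _ _)); apply: (le_trans (lerD (wS _) IH)).
  rewrite addrCA lerD2l -subr_ge0 exprS.
  set q := 2^-1 ^+ (n + m)%N.
  suff -> : - (2^-1 * q) - (2^-1 * q - q) = 0 by [].
  by rewrite opprB addrCA -opprD -mulrDl add_halves mul1r subrr.
have distW (n m : nat) : (n <= m)%N -> `|w m - w n| <= 2^-1 ^+ n.
  move=> /subnKC <-; apply: le_trans (dist _ _) _.
  by rewrite gerBl exprn_ge0 // invr_ge0.
have cw : cvg (w @ \oo).
  apply: cauchy_cvg; apply: cauchy_exP => e e0.
  have [n ne] := geometric_lt e0; exists (w n); exists n => // m /= nm.
  by rewrite -ball_normE /= distrC (le_lt_trans _ ne) // distW.
exists (lim (w @ \oo)) => n.
apply/ler_addgt0Pr => e e0.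
move/cvgrPdist_lt : cw => /(_ e e0) [N _ NP].
rewrite -(subrK (w (maxn n N)) (lim (w @ \oo))) -addrA addrC.
apply: le_trans (ler_normD _ _) _; apply: lerD.
  by apply: distW; apply: leq_maxl.
by apply: ltW; apply: NP; apply: leq_maxr.
Qed.

End Geometric.

(** * Bounds for *-homomorphisms *)

Section StarHomContinuous.
Context {R : realType}.
Implicit Types A B : cstarAlgType R.

Lemma subr_sqr_noncomm A (x y : A) : x * x - y * y = (x - y) * x + y * (x - y).
Proof. by rewrite mulrBl mulrBr addrA subrK. Qed.

(** Writing y = 1 - w, the equation y^2 = 1 - h^2 becomes the fixed-point
    equation w = (h^2 + w^2) / 2.  On the ball of radius 1/2 the right-hand side
    is a contraction of ratio 1/2; all iterates from 0 are self-adjoint and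
    commute with h, and both properties pass to the limit.  Bounding h by 1/2
    rather than 1 loses nothing for continuity and keeps the estimates
    elementary. *)
Lemma sqrt_one_sub_sqr A (h : A) : star h = h -> `|h| <= 2^-1 ->
  exists y : A, [/\ star y = y, h * y = y * h & y * y = 1 - h * h].
Proof.
move=> hs hle.
have s0 : 0 <= 2^-1 :> R[i] by rewrite invr_ge0.
have halves (a : R[i]) : a = a * 2^-1 + 2^-1 * a.
  by rewrite mulrC -mulrDl add_halves mul1r.
have conj_half : (2^-1 : R[i])^* = 2^-1 by apply/CrealP; apply: ger0_real.
have normh : `|2^-1 : R[i]| = 2^-1 by rewrite ger0_norm.
have s1 : 2^-1 <= 1 :> R[i] by rewrite -[leRHS]add_halves lerDl.
have prod_le (x y : A) (a b : R[i]) : `|x| <= a -> `|y| <= b -> `|x * y| <= a * b.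
  by move=> xa yb; apply: le_trans (normr_mul _ _) _; apply: ler_pM.
pose phi (w : A) : A := 2^-1 *: (h * h + w * w).
have phi_lip (v w : A) : `|v| <= 2^-1 -> `|w| <= 2^-1 ->
    `|phi v - phi w| <= 2^-1 * `|v - w|.
  move=> v1 w1; rewrite /phi -scalerBr normrZ normh ler_wpM2l //.
  rewrite opprD addrACA subrr add0r subr_sqr_noncomm.
  apply: le_trans (ler_normD _ _) _.
  by rewrite [leRHS]halves; apply: lerD; apply: prod_le.
have phi_ball (w : A) : `|w| <= 2^-1 -> `|phi w| <= 2^-1.
  move=> w1; rewrite /phi normrZ normh -[leRHS]mulr1 ler_wpM2l //.
  apply: le_trans (ler_normD _ _) _; rewrite -[leRHS]add_halves; apply: lerD.
    by rewrite -[leRHS]mulr1; apply: prod_le => //; apply: le_trans s1.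
  by rewrite -[leRHS]mulr1; apply: prod_le => //; apply: le_trans s1.
pose w n := iter n phi 0.
have wball n : `|w n| <= 2^-1.
  by elim: n => [|n IH]; [rewrite normr0|apply: phi_ball].
have wS n : `|w n.+1 - w n| <= 2^-1 ^+ n.+1.
  elim: n => [|n IH]; first by rewrite subr0 expr1; exact: wball.
  rewrite exprS; apply: le_trans (phi_lip (w n.+1) (w n) (wball _) (wball _)) _.
  by rewrite ler_wpM2l.
have ws n : star (w n) = w n.
  elim: n => [|n IH]; first exact: star0.
  by rewrite /= /phi starZ conj_half starD !starM hs IH.
have wh n : h * w n = w n * h.
  elim: n => [|n IH]; first by rewrite /= mulr0 mul0r.
  rewrite /= /phi -scalerAr -scalerAl mulrDr mulrDl -!mulrA; congr (_ *: (_ + _)).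
  by rewrite -IH !mulrA IH.
have [l lw] := geometric_cvg wS.
have lball : `|l| <= 2^-1.
  apply/ler_addgt0Pr => e /geometric_lt [n ne].
  rewrite -(subrK (w n) l) addrC; apply: le_trans (ler_normD _ _) _.
  by apply: lerD (wball n) _; apply: le_trans (lw n) (ltW ne).
have lphi : l = phi l.
  apply/subr0_eq; apply: (@le_geometric_eq0 _ _ _ 1) => // n.
  rewrite -{1}(subrK (w n.+1) l) -addrA mul1r.
  apply: le_trans (ler_normD _ _) _.
  rewrite [leRHS]halves; apply: lerD; first by rewrite -exprSr.
  apply: le_trans (phi_lip _ _ (wball n) lball) _.
  by rewrite distrC ler_wpM2l.
have lstar : star l = l.
  apply/subr0_eq; apply: (@le_geometric_eq0 _ _ _ 2) => // n.
  have -> : star l - l = star (l - w n) + (w n - l).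
    by rewrite starB ws addrA subrK.
  rewrite mulrDl mul1r.
  apply: le_trans (ler_normD _ _) _.
  by apply: lerD; [rewrite normr_star|rewrite distrC].
have lh : h * l = l * h.
  apply/subr0_eq; apply: (@le_geometric_eq0 _ _ _ 1) => // n; rewrite mul1r.
  have -> : h * l - l * h = h * (l - w n) + (w n - l) * h.
    by rewrite mulrBr mulrBl wh addrA subrK.
  apply: le_trans (ler_normD _ _) _.
  rewrite [leRHS]halves [leRHS]addrC.
  by apply: lerD; apply: prod_le => //; rewrite distrC.
have l2 : l + l = h * h + l * l.
  by rewrite {1 2}lphi /phi -scalerDl add_halves scale1r.
exists (1 - l); split.
- by rewrite starB star1 lstar.
- by rewrite mulrBl mulrBr mulr1 mul1r lh.
- rewrite mulrBl !mulrBr !mulr1 mul1r.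
  apply: (addIr (h * h + l * l)); rewrite -{1}l2.
  by rewrite opprB !addrA !subrK addrAC subrK.
Qed.

(** With y a square root of 1 - h^2 commuting with h, the element u = h + i y
    satisfies u^* u = 1, so g u is an isometry and has norm 1, while g h is the
    mean of g u and its adjoint. *)
Lemma star_hom_normr_selfadj A B (g : {lrmorphism A -> B}) (h : A) :
  is_star_hom g -> star h = h -> `|h| <= 2^-1 -> `|g h| <= 1.
Proof.
move=> gs hs hle; have [y [ys hy yy]] := sqrt_one_sub_sqr hs hle.
pose u := h + ('i : R[i]) *: y.
have us : star u = h - ('i : R[i]) *: y.
  by rewrite /u starD starZ conjCi hs ys scaleNr.
have ii : 'i * 'i = -1 :> R[i] by rewrite -expr2 sqrCi.
have uu : star u * u = 1.
  rewrite us /u mulrBl !mulrDr -!scalerAl -!scalerAr scalerA ii scaleN1r hy.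
  by rewrite opprB addrACA subrr addr0 yy addrC subrK.
have gu : `|g u| = 1.
  by apply: normr_isometry; rewrite /Defs.isometry -gs -rmorphM uu rmorph1.
have -> : g h = 2^-1 *: (g u + star (g u)).
  rewrite -gs us -rmorphD /u addrACA subrr addr0 rmorphD.
  by rewrite scalerDr -scalerDl add_halves scale1r.
rewrite normrZ ger0_norm ?invr_ge0 //.
rewrite ler_pdivrMl // mulr1; apply: le_trans (ler_normD _ _) _.
by rewrite normr_star gu.
Qed.

(** Rescaling turns the bound on the ball of radius 1/2 into one for all
    self-adjoint elements; the C*-identity then reduces x to x^* x. *)
Lemma star_hom_normr A B (g : {lrmorphism A -> B}) (x : A) :
  is_star_hom g -> `|g x| <= 2 * `|x|.
Proof.
move=> gs.
have sa (h : A) : star h = h -> `|g h| <= 2 * `|h|.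
  move=> hs; have [->|h0] := eqVneq h 0; first by rewrite linear0 !normr0 mulr0.
  have h_gt0 : 0 < `|h| by rewrite normr_gt0.
  have c_gt0 : 0 < 2 * `|h| by rewrite mulr_gt0.
  pose c := (2 * `|h|)^-1.
  have c_ge0 : 0 <= c by rewrite invr_ge0 ltW.
  have ch : c * `|h| = 2^-1 by rewrite /c invfM -mulrA mulVf ?gt_eqF // mulr1.
  have cs : c^* = c by apply/CrealP; apply: ger0_real.
  have := @star_hom_normr_selfadj _ _ g (c *: h) gs.
  rewrite starZ cs hs normrZ ger0_norm // linearZ /= normrZ ger0_norm //.
  by rewrite ch ler_pdivrMl // mulr1; apply.
rewrite -(@ler_pXn2r _ 2) ?nnegrE ?mulr_ge0 // -normr_starM -gs -rmorphM.
apply: le_trans (sa _ _) _; first by rewrite starM starK.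
by rewrite normr_starM exprMn ler_wpM2r ?exprn_ge0 // expr2 ler_peMl // ler1n.
Qed.

End StarHomContinuous.

(** * Continuity *)

Section Continuity.
Context {R : realType}.
Implicit Types A B : cstarAlgType R.

Lemma additive_bounded_continuous A B (f : A -> B) (C : R[i]) : 0 < C ->
  {morph f : x y / x - y} -> (forall x, `|f x| <= C * `|x|) -> continuous f.
Proof.
move=> C_gt0 fB fC x; apply/cvgrPdist_lt => e e_gt0.
have : \forall z \near x, `|x - z| < e / C.
  by apply: cvgr_dist_lt; rewrite ?divr_gt0 //; exact: cvg_id.
apply: filterS => z; rewrite ltr_pdivlMr // mulrC -fB => ze.
exact: le_lt_trans (fC _) ze.
Qed.

Lemma star_hom_continuous A B (f : {lrmorphism A -> B}) :
  is_star_hom f -> continuous f.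
Proof.
move=> fs; apply: (@additive_bounded_continuous _ _ _ 2) => // [x y|x].
  exact: linearB.
exact: star_hom_normr.
Qed.

Lemma mul_continuous A (a b : A) : continuous (fun x => a * x * b).
Proof.
(* The summand 1 keeps the constant positive when a or b is 0. *)
have C_gt0 : 0 < `|a| * `|b| + 1 by rewrite ltr_wpDl // mulr_ge0.
apply: (additive_bounded_continuous C_gt0) => [x y|x].
  by rewrite mulrBr mulrBl.
rewrite mulrDl mul1r; apply: le_trans (normr_mul _ _) _.
apply: (@le_trans _ _ (`|a| * `|x| * `|b|)).
  by rewrite ler_wpM2r // normr_mul.
by rewrite mulrAC lerDl.
Qed.

End Continuity.

(** * C*-subalgebras and generators *)

Section Subalgebra.
Context {R : realType}.
Implicit Types A B C : cstarAlgType R.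

Lemma cstar_gen_subalgebra A (G : set A) : is_cstar_subalgebra (cstar_gen G).
Proof.
split.
- by move=> M [MS _]; apply: cstar_sub0 MS.
- by move=> x y Gx Gy M MG; apply: (cstar_subD MG.1); [apply: Gx|apply: Gy].
- by move=> a x Gx M MG; apply: (cstar_subZ MG.1); apply: Gx.
- by move=> x y Gx Gy M MG; apply: (cstar_subM MG.1); [apply: Gx|apply: Gy].
- by move=> x Gx M MG; apply: (cstar_sub_star MG.1); apply: Gx.
- by apply: closed_bigI => M [MS _]; apply: cstar_sub_closed MS.
Qed.

Lemma cstar_gen_in A (G : set A) x : G x -> cstar_gen G x.
Proof. exact: sub_gen_smallest. Qed.

(** Closedness of the equalizer is where continuity of *-homomorphisms enters;
    it makes *-homomorphisms determined by their values on generators. *)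
Lemma star_hom_eq_subalgebra A B (f g : {lrmorphism A -> B}) :
  is_star_hom f -> is_star_hom g -> is_cstar_subalgebra [set x | f x = g x].
Proof.
move=> fs gs; split.
- by rewrite /= !linear0.
- by move=> x y /= fgx fgy; rewrite !rmorphD /= fgx fgy.
- by move=> a x /= fgx; rewrite !linearZ /= fgx.
- by move=> x y /= fgx fgy; rewrite !rmorphM /= fgx fgy.
- by move=> x /= fgx; rewrite fs gs fgx.
have -> : [set x | f x = g x] = (fun x => f x - g x) @^-1` [set 0].
  by apply/seteqP; split => x /=; [move=> ->; rewrite subrr|move/subr0_eq].
apply: preimage_closed; last first.
  by apply: accessible_closed_set1; apply: hausdorff_accessible.
by move=> x _; apply: continuousB; apply: star_hom_continuous.
Qed.

Lemma star_hom_eq_on_gen A B (f g : {lrmorphism A -> B}) (G : set A) :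
    is_star_hom f -> is_star_hom g -> (forall x, G x -> f x = g x) ->
  forall x, cstar_gen G x -> f x = g x.
Proof. by move=> fs gs; exact: smallest_sub (star_hom_eq_subalgebra fs gs). Qed.

Lemma star_hom_comp A B C
    (f : {lrmorphism B -> C}) (g : {lrmorphism A -> B}) :
  is_star_hom f -> is_star_hom g ->
  exists h : {lrmorphism A -> C}, is_star_hom h /\ forall x, h x = f (g x).
Proof. by move=> fs gs; exists (f \o g); split=> // x /=; rewrite gs fs. Qed.

Lemma star_hom_id_on_gen A (h : {lrmorphism A -> A}) (G : set A) :
  is_star_hom h -> (forall x, G x -> h x = x) ->
  forall x, cstar_gen G x -> h x = x.
Proof. by move=> hs; apply: (@star_hom_eq_on_gen _ _ h idfun). Qed.

End Subalgebra.

(** * Adjoining a self-adjoint unitary to a C*-subalgebra *)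

Section Graded.
Context {R : realType} {A : cstarAlgType R}.

Lemma conj_subalgebra (F : set A) (W : A) : is_cstar_subalgebra F ->
  star W = W -> W * W = 1 -> is_cstar_subalgebra [set x | F (W * x * W)].
Proof.
move=> FS Ws WW; split => /=.
- by rewrite mulr0 mul0r; exact: cstar_sub0.
- by move=> x y Fx Fy; rewrite mulrDr mulrDl; exact: cstar_subD.
- by move=> a x Fx; rewrite -scalerAr -scalerAl; exact: cstar_subZ.
- move=> x y Fx Fy; have -> : W * (x * y) * W = (W * x * W) * (W * y * W).
    by rewrite !mulrA -(mulrA _ W W) WW mulr1.
  exact: cstar_subM.
- move=> x Fx; have -> : W * star x * W = star (W * x * W).
    by rewrite !starM Ws mulrA.
  exact: cstar_sub_star.
apply: (@preimage_closed _ _ (fun x : A => W * x * W)).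
  by move=> x _; exact: mul_continuous.
exact: cstar_sub_closed FS.
Qed.

Lemma cstar_gen_swap (V1 V2 W : A) : star W = W -> W * W = 1 ->
    W * V1 * W = V2 -> W * V2 * W = V1 ->
  forall x, cstar_gen [set V1; V2] x -> cstar_gen [set V1; V2] (W * x * W).
Proof.
move=> Ws WW WV1 WV2; apply: smallest_sub.
  by apply: conj_subalgebra => //; exact: cstar_gen_subalgebra.
move=> x [] -> /=; rewrite ?WV1 ?WV2; apply: cstar_gen_in; [by right|by left].
Qed.

(** Products stay in F + W F because W q = (W q W) W with W q W in F.  The map
    alpha makes F + W F closed: it recovers the components of x = p + W q
    continuously, as p = (x + alpha x) / 2 and q = W (x - alpha x) / 2. *)
Lemma graded_subalgebra (F : set A) (W : A) (alpha : {lrmorphism A -> A}) :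
    is_cstar_subalgebra F -> star W = W -> W * W = 1 ->
    (forall x, F x -> F (W * x * W)) ->
    is_star_hom alpha -> (forall x, F x -> alpha x = x) -> alpha W = - W ->
  is_cstar_subalgebra [set x | exists p q, [/\ F p, F q & x = p + W * q]].
Proof.
move=> FS Ws WW WF alphas alphaF alphaW.
split => /=.
- exists 0, 0; split; [exact: cstar_sub0..|by rewrite mulr0 addr0].
- move=> _ _ [p [q [Fp Fq ->]]] [r [s [Fr Fs ->]]].
  exists (p + r), (q + s); split; [exact: cstar_subD..|].
  by rewrite mulrDr addrACA.
- move=> a _ [p [q [Fp Fq ->]]].
  exists (a *: p), (a *: q); split; [exact: cstar_subZ..|].
  by rewrite scalerDr scalerAr.
- move=> _ _ [p [q [Fp Fq ->]]] [r [s [Fr Fs ->]]].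
  exists (p * r + (W * q * W) * s), ((W * p * W) * s + q * r).
  split; [by apply: cstar_subD => //; apply: cstar_subM => //; exact: WF..|].
  by rewrite mulrDl !mulrDr !mulrA WW mul1r -!addrA (addrC (W * q * W * s)) !addrA.
- move=> _ [p [q [Fp Fq ->]]].
  exists (star p), (W * star q * W); split.
  + exact: cstar_sub_star.
  + by apply: WF; exact: cstar_sub_star.
  + by rewrite starD starM Ws !mulrA WW mul1r.
have -> : [set x | exists p q, [/\ F p, F q & x = p + W * q]] =
    (fun x => x + alpha x) @^-1` F `&` (fun x => W * (x - alpha x)) @^-1` F.
  apply/seteqP; split => [_ [p [q [Fp Fq ->]]]|x [/= Fp Fq]].
    have alphapq : alpha (p + W * q) = p - W * q.
      by rewrite rmorphD rmorphM /= (alphaF p) // (alphaF q) // alphaW mulNr.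
    split; rewrite /= alphapq.
      by rewrite addrACA subrr addr0; exact: cstar_subD.
    have -> : p + W * q - (p - W * q) = W * q + W * q.
      by rewrite opprD opprK addrACA subrr add0r.
    by rewrite -mulrDr mulrA WW mul1r; exact: cstar_subD.
  exists (2^-1 *: (x + alpha x)), (2^-1 *: (W * (x - alpha x))).
  split; [exact: cstar_subZ..|].
  rewrite -scalerAr mulrA WW mul1r -scalerDr addrACA subrr addr0.
  by rewrite scalerDr -scalerDl add_halves scale1r.
have alphac := star_hom_continuous alphas.
apply: closedI; apply: preimage_closed (cstar_sub_closed FS) => x _.
  by apply: continuousD; [exact: cvg_id|exact: alphac].
have -> : (fun y => W * (y - alpha y)) =
    (fun y => W * y * 1) \o (fun y => y - alpha y).
  by apply/funext => y /=; rewrite mulr1.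
apply: continuous_comp; last exact: mul_continuous.
by apply: continuousB; [exact: cvg_id|exact: alphac].
Qed.

End Graded.

(** * Cuntz relations and the flip *)

Section Cuntz.
Context {R : realType} {A : cstarAlgType R}.

(** Compressing S1 S1^* + S2 S2^* = 1 by S1 gives 1 + z^* z = 1 for
    z = S2^* S1, so the C*-identity forces z = 0. *)
Lemma cuntz2_orth (S1 S2 : A) : cuntz2_rel S1 S2 ->
  star S1 * S2 = 0 /\ star S2 * S1 = 0.
Proof.
move=> [i1 i2 s12]; rewrite /Defs.isometry in i1 i2.
have z21 : star S2 * S1 = 0.
  apply/eqP; rewrite -normr_eq0 -sqrf_eq0 -normr_starM normr_eq0 starM starK.
  have := congr1 (fun x => star S1 * x * S1) s12.
  rewrite mulrDr mulrDl mulr1 !mulrA i1 mul1r i1 -[RHS]addr0 -!mulrA.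
  by move=> /addrI ->.
by split=> //; rewrite -[X in _ * X]starK -starM z21 star0.
Qed.

(** The condition on c says |c| = 1 / sqrt 2, so that this is a unitary change
    of basis in the Hilbert space spanned by S1 and S2. *)
Lemma cuntz2_hadamard (S1 S2 : A) (c : R[i]) : c^* * c = 2^-1 ->
  cuntz2_rel S1 S2 -> cuntz2_rel (c *: (S1 + S2)) (c *: (S1 - S2)).
Proof.
move=> cc rS; have [z12 z21] := cuntz2_orth rS.
case: rS => i1 i2 s12; rewrite /Defs.isometry in i1 i2.
have cc' : c * c^* = 2^-1 by rewrite mulrC.
split; rewrite /Defs.isometry !starZ -!scalerAr -!scalerAl !scalerA ?cc ?cc'.
- rewrite starD mulrDl !mulrDr i1 i2 z12 z21 addr0 add0r.
  by rewrite scalerDr -scalerDl add_halves scale1r.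
- rewrite starB mulrBl !mulrBr i1 i2 z12 z21 subr0 sub0r opprK.
  by rewrite scalerDr -scalerDl add_halves scale1r.
- rewrite starB starD -scalerDr mulrDl mulrBl 2!mulrDr 2!mulrBr opprB.
  rewrite addrACA [S1 * _ + _ + _]addrACA subrr addr0.
  rewrite [S2 * _ + S2 * _]addrC [_ + (S2 * _ - _)]addrACA subrr addr0.
  by rewrite addrACA s12 scalerDr -scalerDl add_halves scale1r.
Qed.

(** Inside the Cuntz algebra, U exchanges S1 and S2 under left multiplication;
    hence U S1 U = S2 U has the same range projection as S2. *)
Lemma cuntz2_implements_flip (S1 S2 : A) : cuntz2_rel S1 S2 ->
  let U := S1 * star S2 + S2 * star S1 in
  cuntz2_flip_rel S1 (S2 * U) U.
Proof.
move=> rS U; have [z12 z21] := cuntz2_orth rS.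
case: rS => i1 i2 s12; rewrite /Defs.isometry in i1 i2.
have Us : star U = U by rewrite /U starD !starM !starK addrC.
have US1 : U * S1 = S2.
  by rewrite /U mulrDl -!mulrA i1 z21 mulr0 add0r mulr1.
have US2 : U * S2 = S1.
  by rewrite /U mulrDl -!mulrA i2 z12 mulr0 addr0 mulr1.
have UU : U * U = 1 by rewrite {2}/U mulrDr !mulrA US1 US2 addrC.
split; last by rewrite -mulrA UU mulr1.
- split=> //; rewrite /Defs.isometry starM Us.
    by rewrite mulrA -(mulrA U) i2 mulr1.
  by rewrite mulrA -(mulrA S2) UU mulr1.
- by split; rewrite Us.
- by rewrite expr2.
Qed.

Lemma cuntz2_flip_rel_selfadj (V1 V2 W : A) : cuntz2_flip_rel V1 V2 W ->
  [/\ star W = W, W * W = 1, W * V1 * W = V2 & W * V2 * W = V1].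
Proof.
move=> [_ [sWW _] W2 WV].
have WW : W * W = 1 by rewrite -expr2.
have Ws : star W = W by rewrite -[LHS]mulr1 -WW mulrA sWW mul1r.
have V2E : W * V1 * W = V2 by rewrite WV -mulrA WW mulr1.
by split=> //; rewrite -V2E !mulrA WW mul1r -mulrA WW mulr1.
Qed.

(** W V1 = V2 W has the same range projection as V2. *)
Lemma cuntz2_flip_rel_cuntz2 (V1 V2 W : A) : cuntz2_flip_rel V1 V2 W ->
  cuntz2_rel V1 (W * V1).
Proof.
move=> rV; have [Ws WW _ _] := cuntz2_flip_rel_selfadj rV.
case: rV => [[i1 i2 s12] _ _ WV]; rewrite /Defs.isometry in i1 i2.
split=> //.
  by rewrite /Defs.isometry starM Ws mulrA -(mulrA (star V1)) WW mulr1.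
by rewrite WV starM Ws mulrA -(mulrA V2) WW mulr1.
Qed.

(** The unitary built from V1 and W V1 as in [cuntz2_implements_flip] is W
    again: this makes the two maps of the theorem mutually inverse. *)
Lemma cuntz2_flip_symmetryE (V1 V2 W : A) :
  cuntz2_flip_rel V1 V2 W ->
  V1 * star (W * V1) + W * V1 * star V1 = W.
Proof.
move=> rV; have [Ws WW WV1 WV2] := cuntz2_flip_rel_selfadj rV.
case: rV => [[_ _ s12] _ _ WV].
have V2W : star V2 = W * star V1 * W by rewrite -WV1 !starM Ws mulrA.
rewrite -[RHS]mulr1 -s12 mulrDr mulrA addrC; congr (_ + _).
by rewrite starM Ws V2W !mulrA WV2.
Qed.

Lemma hadamardK (c : R[i]) (x y : A) :
    c * c = 2^-1 ->
  c *: (c *: (x + y) + c *: (x - y)) = x /\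
  c *: (c *: (x + y) - c *: (x - y)) = y.
Proof.
move=> cc.
rewrite -scalerBr -scalerDr !scalerA cc; split.
  by rewrite addrACA subrr addr0 scalerDr -scalerDl add_halves scale1r.
by rewrite opprB addrC addrA subrK scalerDr -scalerDl add_halves scale1r.
Qed.

(** As F + W F contains the generators, every x is p + W q with p and q in F;
    then alpha x = p - W q, so a fixed point has W q = 0.  This is the description
    of the canonical copy of O_2 as the fixed-point algebra of the dual action. *)
Lemma dual_action_fixed (V1 V2 W : A)
    (alpha : {lrmorphism A -> A}) :
    cuntz2_flip_rel V1 V2 W -> cstar_gen [set V1; V2; W] = setT ->
    is_star_hom alpha -> alpha V1 = V1 -> alpha V2 = V2 -> alpha W = - W ->
  forall x, alpha x = x <-> cstar_gen [set V1; V2] x.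
Proof.
move=> rV genA alphas alpha1 alpha2 alphaW.
have [Ws WW WV1 WV2] := cuntz2_flip_rel_selfadj rV.
case: rV => [[_ _ s12] _ _ _].
set F := cstar_gen [set V1; V2].
have FS : is_cstar_subalgebra F := cstar_gen_subalgebra _.
have F1 : F V1 by apply: cstar_gen_in; left.
have F2 : F V2 by apply: cstar_gen_in; right.
have F0 : F 0 := cstar_sub0 FS.
have Fone : F 1.
  by rewrite -s12; apply: (cstar_subD FS); apply: (cstar_subM FS) => //;
     exact: (cstar_sub_star FS).
have alphaF x : F x -> alpha x = x.
  by apply: star_hom_id_on_gen => // y [] ->.
have DS := graded_subalgebra FS Ws WW (cstar_gen_swap Ws WW WV1 WV2) alphas
  alphaF alphaW.
move=> x; split; last exact: alphaF.
have [p [q [Fp Fq ->]]] : [set y | exists p q, [/\ F p, F q & y = p + W * q]] x.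
  have: cstar_gen [set V1; V2; W] x by rewrite genA.
  apply: (smallest_sub DS) => y [[]|] -> /=.
  - by exists V1, 0; split=> //; rewrite mulr0 addr0.
  - by exists V2, 0; split=> //; rewrite mulr0 addr0.
  - by exists 0, 1; split=> //; rewrite mulr1 add0r.
rewrite rmorphD rmorphM /= alphaW (alphaF p Fp) (alphaF q Fq) mulNr.
move=> /addrI Wq0; suff -> : W * q = 0 by rewrite addr0.
apply/eqP; rewrite -normr_eq0; apply/eqP.
have : W * q *+ 2 = 0 by rewrite mulr2n -{1}Wq0 addNr.
rewrite -scaler_nat => /eqP; rewrite scaler_eq0 pnatr_eq0 /= => /eqP ->.
by rewrite normr0.
Qed.

End Cuntz.

(* O is O_2 with canonical isometries S1, S2; A is its crossed product by the
   flip sigma, with canonical generators V1, V2 (the isometries) and W. *)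
Theorem proposition3p1 (R : realType)
  (O : cstarAlgType R) (S1 S2 : O) (hO : is_cuntz2 S1 S2)
  (sigma : {lrmorphism O -> O}) (hsigma : is_star_isom sigma)
  (hsigma1 : sigma S1 = S2) (hsigma2 : sigma S2 = S1)
  (A : cstarAlgType R) (V1 V2 W : A)
  (hA : is_cuntz2_flip_crossed_product V1 V2 W) :
  exists tau : {lrmorphism A -> O},
    is_star_isom tau /\
    tau @` cstar_gen [set V1; V2] = [set a : O | sigma a = a].
Proof.
case: hO hA => rS genO univO [rV genA univA]; case: hsigma => sigmas _.
pose c : R[i] := (sqrtC 2)^-1.
have cc : c * c = 2^-1 by rewrite -expr2 exprVn sqrtCK.
have cs : c^* = c by apply/CrealP; rewrite ger0_real // invr_ge0 sqrtC_ge0.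
have ccs : c^* * c = 2^-1 by rewrite cs.
pose T1 := c *: (S1 + S2); pose T2 := c *: (S1 - S2).
have rT : cuntz2_rel T1 T2 := cuntz2_hadamard ccs rS.
pose U := T1 * star T2 + T2 * star T1.
have rU : cuntz2_flip_rel T1 (T2 * U) U := cuntz2_implements_flip rT.
have [Us UU UT1 UT2] := cuntz2_flip_rel_selfadj rU.
have [tau [taus tau1 tau2 tauW]] := univA _ _ _ _ rU.
have [f [fs f1 f2]] := univO _ _ _ (cuntz2_hadamard ccs (cuntz2_flip_rel_cuntz2 rV)).
have [Ws WW WV1 WV2] := cuntz2_flip_rel_selfadj rV.
have [SK1 SK2] := hadamardK S1 S2 cc.
have [VK1 VK2] := hadamardK V1 (W * V1) cc.
have fT1 : f T1 = V1 by rewrite linearZ rmorphD /= f1 f2 VK1.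
have fT2 : f T2 = W * V1 by rewrite linearZ rmorphB /= f1 f2 VK2.
have fU : f U = W.
  by rewrite rmorphD !rmorphM /= !fs fT1 fT2 (cuntz2_flip_symmetryE rV).
have UT : U * T1 = T2 by rewrite -[LHS]mulr1 -UU mulrA UT1 -mulrA UU mulr1.
have [tf [tfs tfE]] := star_hom_comp taus fs.
have [ft [fts ftE]] := star_hom_comp fs taus.
have tauK : cancel tau f.
  move=> x; rewrite -ftE.
  apply: (@star_hom_id_on_gen _ _ _ [set V1; V2; W]); rewrite ?genA //.
  move=> y [[]|] ->; rewrite ftE.
  - by rewrite tau1 fT1.
  - by rewrite tau2 rmorphM /= fT2 fU WV1.
  - by rewrite tauW fU.
have fK : cancel f tau.
  move=> x; rewrite -tfE.
  apply: (@star_hom_id_on_gen _ _ _ [set S1; S2]); rewrite ?genO //.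
  move=> y [] ->; rewrite tfE.
  - by rewrite f1 linearZ rmorphD rmorphM /= tau1 tauW UT SK1.
  - by rewrite f2 linearZ rmorphB rmorphM /= tau1 tauW UT SK2.
have sT1 : sigma T1 = T1 by rewrite linearZ rmorphD /= hsigma1 hsigma2 addrC.
have sT2 : sigma T2 = - T2.
  by rewrite linearZ rmorphB /= hsigma1 hsigma2 -scalerN opprB.
have sU : sigma U = - U.
  by rewrite rmorphD !rmorphM /= !sigmas sT1 sT2 starN mulrN mulNr -opprD.
have sT2U : sigma (T2 * U) = T2 * U by rewrite rmorphM /= sT2 sU mulrNN.
have [st [sts stE]] := star_hom_comp sigmas taus.
have [alpha [alphas alphaE]] := star_hom_comp fs sts.
(* alpha = f sigma tau is the dual action of the crossed product. *)
have fixed x : alpha x = x <-> cstar_gen [set V1; V2] x.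
  apply: (dual_action_fixed rV) => //; rewrite alphaE stE.
  - by rewrite tau1 sT1 fT1.
  - by rewrite tau2 sT2U -tau2 tauK.
  - by rewrite tauW sU rmorphN /= fU.
exists tau; split; first by split=> //; exists f.
apply/seteqP; split => [_ [x /fixed ax <-]|a sa] /=.
  by rewrite -[LHS]fK -stE -alphaE ax.
by exists (f a); [apply/fixed; rewrite alphaE stE fK sa|exact: fK].
Qed.
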